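(* Let $r,n\ge 1$ be integers and $c,d\in\mathbb{Z}$. Let $B_{c,d}$ be the $r\times r$ integer matrix with all diagonal entries $c$ and all off-diagonal entries $d$, and let $S_{cochar}(c,d,r,n)$ be the number of $\boldsymbol{x}\in(\mathbb{Z}/n\mathbb{Z})^r$ with $B_{c,d}\boldsymbol{x}\equiv\boldsymbol{0}\pmod n$. Put $\mathscr{d}_1=\gcd(c-d,n)$ and $\mathscr{d}_2=\gcd(c+(r-1)d,n)$. Then \[S_{cochar}(c,d,r,n)=\mathscr{d}_1^{\,r-1}\gcd\left(\mathscr{d}_2,\frac{dn}{\mathscr{d}_1}\right).\]
   Context: Equivalently, $S_{cochar}(c,d,r,n)=|\Lambda_{fin}|$ where $\Lambda_{fin}=\{\boldsymbol{x}\in(\mathbb{Z}/n\mathbb{Z})^r:\boldsymbol{x}^TB_{c,d}\boldsymbol{y}\equiv 0\pmod n\ \forall \boldsymbol{y}\in(\mathbb{Z}/n\mathbb{Z})^r\}$. *)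

(* Defs.v *)
From mathcomp Require Import all_boot all_order all_algebra.
Set Implicit Arguments.
Unset Strict Implicit.
Unset Printing Implicit Defensive.
Import Order.TTheory GRing.Theory Num.Theory.
Local Open Scope ring_scope.

Definition Bmx (r : nat) (c d : int) : 'M[int]_r :=
  \matrix_(i, j) (if i == j then c else d).

(* Z/nZ is represented by the residues 0, ..., n-1, i.e. by 'I_n; the type 'Z_n
   would be wrong for n = 1. *)
Definition lift_residues (r n : nat) (x : 'cV['I_n]_r) : 'cV[int]_r :=
  map_mx (fun k : 'I_n => (k : nat)%:Z) x.

Definition S_cochar (c d : int) (r n : nat) : nat :=
  #|[set x : 'cV['I_n]_r |
      [forall i : 'I_r,
        (((Bmx r c d *m lift_residues x) i 0)%R == 0 %[mod n%:Z])%Z]]|.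

(* Main.v *)
(** Subtracting the rows of [B x = 0 mod n] turns it into [(c - d) y_i = 0] and
    [(c + (r - 1) d) x_0 + d (y_1 + ... + y_(r-1)) = 0], where [y_i = x_i - x_0].
    Each [y_i] ranges over a subgroup of order [d1]; translating [y_1] by the
    other [y_i] replaces the sum by [y_1] alone, which yields the factor
    [d1 ^ (r - 2)] and leaves two unknowns [x_0], [y_1].  For fixed [y_1] there
    are [d2] or no values of [x_0], according to whether [d2] divides [d y_1];
    the admissible [y_1] are the multiples of [(n / d1) (d2 / gcd(d2, d n / d1))].
    For [r = 1] the formula says that [d2] divides [d n / d1]. *)
Require Import Defs.
From mathcomp Require Import all_boot all_order all_algebra.
From mathcomp Require Import ring zify.
Import Order.TTheory GRing.Theory Num.Theory.
Local Open Scope ring_scope.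

Lemma sum_cV_recl (T : finType) (m : nat) (F : 'cV[T]_m.+1 -> nat) :
  (\sum_x F x =
   \sum_(t : T) \sum_(y : 'cV[T]_m) F (col_mx (const_mx t : 'cV_1) y))%N.
Proof.
rewrite pair_big /=.
rewrite (reindex (fun p : T * 'cV[T]_m =>
  (col_mx (const_mx p.1 : 'cV_1) p.2 : 'cV_m.+1))) //=.
exists (fun x : 'cV[T]_(1 + m) => (usubmx x 0 0, dsubmx x)) => [[t y] _|x _] /=.
  by rewrite col_mxKu col_mxKd mxE.
rewrite -[RHS](@vsubmxK T 1 m 1 x); set u := const_mx _.
suff -> : u = usubmx (x : 'cV_(1 + m)) by [].
by apply/matrixP => i j; rewrite !ord1 mxE.
Qed.

Lemma dvdz_congr (n u v : int) : (n %| u - v)%Z -> (n %| u)%Z = (n %| v)%Z.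
Proof. by move=> n_dvd; rewrite -[u](subrK v) rpredDl. Qed.

(** Translation by [t] followed by reduction mod [n] permutes the residues, and a periodic [F] does
    not notice the reduction. *)
Lemma sum_residues_shift (n : nat) (F : int -> nat) (t : int) : (0 < n)%N ->
  (forall z w, (n%:Z %| z - w)%Z -> F z = F w) ->
  (\sum_(k < n) F (k%:Z + t)%R = \sum_(k < n) F k%:Z)%N.
Proof.
move=> n_gt0 perF.
have n_neq0 : n%:Z != 0 by lia.
have bound (k : 'I_n) : (`|((k%:Z + t)%R %% n%:Z)%Z| < n)%N.
  have := ltz_pmod (k%:Z + t) (_ : 0 < n%:Z); have := modz_ge0 (k%:Z + t) n_neq0.
  by lia.
pose h (k : 'I_n) := Ordinal (bound k).
have hE k : (h k)%:Z = ((k%:Z + t) %% n%:Z)%Z by rewrite /= gez0_abs ?modz_ge0.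
have h_inj : injective h.
  move=> i j /(congr1 (fun k : 'I_n => k%:Z)); rewrite !hE => /eqP.
  rewrite eqz_modDr !modz_nat => /eqP[].
  by rewrite !modn_small ?ltn_ord // => /val_inj.
rewrite [RHS](reindex_inj h_inj); apply: eq_bigr => k _; apply: perF.
by rewrite hE -eqz_mod_dvd modz_mod.
Qed.

Lemma sum_dvdn (q n : nat) : (0 < n)%N -> (q %| n)%N ->
  (\sum_(k < n) (q %| k) = n %/ q)%N.
Proof.
(* [divn_count_dvd] counts over [1..n]; the endpoint [n] is traded for [0], both being multiples of
   [q]. *)
move=> n_gt0 q_dvd_n; rewrite divn_count_dvd big_nat_recr //= q_dvd_n.
rewrite -(big_mkord xpredT (fun k : nat => (q %| k)%N : nat)) big_ltn //.
by rewrite dvdn0 addnC.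
Qed.

(** After cancelling [g], the cofactors [n / g] and [|a| / g] are coprime, so Gauss's lemma
    applies. *)
Lemma dvdz_mul_gcd (n : nat) (a x : int) : (0 < n)%N ->
  (n%:Z %| a * x)%Z = (n %/ gcdn `|a| n %| `|x|)%N.
Proof.
move=> n_gt0; rewrite dvdzE abszM /=; set g := gcdn _ _.
have g_gt0 : (0 < g)%N by rewrite gcdn_gt0 n_gt0 orbT.
rewrite -{1}(divnK (dvdn_gcdr `|a| n : (g %| n)%N)).
rewrite -{1}(divnK (dvdn_gcdl `|a| n : (g %| `|a|)%N)).
rewrite mulnAC dvdn_pmul2r // Gauss_dvdr //.
rewrite /coprime -(eqn_pmul2r g_gt0) muln_gcdl !divnK ?dvdn_gcdl ?dvdn_gcdr //.
by rewrite gcdnC mul1n.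
Qed.

Lemma sum_dvdz_mul (n : nat) (a : int) : (0 < n)%N ->
  (\sum_(k < n) (n%:Z %| (a * k%:Z)%R)%Z = gcdn `|a| n)%N.
Proof.
move=> n_gt0; have g_dvd := dvdn_gcdr `|a| n.
under eq_bigr => k _ do rewrite dvdz_mul_gcd //=.
rewrite sum_dvdn ?dvdn_div //.
by rewrite divnA // mulKn.
Qed.

(** If [b = q * gcd(a, n)], a Bezout relation gives [a k + b = a (k + q u)] mod [n], and the shift
    by [q u] reduces to the homogeneous count. Otherwise there is no solution. *)
Lemma sum_dvdz_affine (n : nat) (a b : int) : (0 < n)%N ->
  (\sum_(k < n) (n%:Z %| (a * k%:Z + b)%R)%Z =
   (gcdz a n%:Z %| b)%Z * gcdn `|a| n)%N.
Proof.
move=> n_gt0; case: (boolP (gcdz a n%:Z %| b)%Z) => [/dvdzP[q bE]|ndvd].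
  have [u [v uvE]] := Bezoutz a n%:Z.
  rewrite mul1n -sum_dvdz_mul //.
  rewrite -(sum_residues_shift n (fun z => (n%:Z %| (a * z)%R)%Z : nat) (q * u)) //.
    apply: eq_bigr => k _; congr (nat_of_bool _); apply: dvdz_congr.
    apply/dvdzP; exists (q * v); rewrite bE -uvE; ring.
  move=> z w zw; congr (nat_of_bool _); apply: dvdz_congr.
  by rewrite -mulrBr dvdz_mull.
rewrite mul0n big1 // => k _; apply/eqP; rewrite eqb0; apply: contra ndvd => n_dvd.
have := dvdz_trans (dvdz_gcdr a n%:Z) n_dvd.
by rewrite rpredDl // dvdz_mulr // dvdz_gcdl.
Qed.

(** The first condition forces [k = h j] with [h = n / g]; the second then says that [q = D / f]
    divides [j]. This leaves [n / (h q) = g / q] values, and [D = q f] clears the denominator. *)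
Lemma sum_dvdz_pair (n D : nat) (e d : int) : (0 < n)%N -> (D %| n)%N ->
  ((\sum_(k < n) (n%:Z %| (e * k%:Z)%R)%Z * (D%:Z %| (d * k%:Z)%R)%Z) * D =
   gcdn `|e| n * gcdn D (`|d| * n %/ gcdn `|e| n))%N.
Proof.
move=> n_gt0 D_dvd; set g := gcdn `|e| n.
have g_dvd : (g %| n)%N := dvdn_gcdr _ _.
have g_gt0 : (0 < g)%N by rewrite gcdn_gt0 n_gt0 orbT.
have D_gt0 : (0 < D)%N by case: D D_dvd => //; rewrite dvd0n; lia.
set h := (n %/ g)%N.
have nE : n = (h * g)%N by rewrite divnK.
have h_gt0 : (0 < h)%N by rewrite divn_gt0 // dvdn_leq.
have -> : (`|d| * n %/ g = `|d| * h)%N by rewrite muln_divA.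
set f := gcdn D _; set q := (D %/ f)%N.
have f_dvd : (f %| D)%N := dvdn_gcdl _ _.
have f_gt0 : (0 < f)%N by rewrite gcdn_gt0 D_gt0.
have D_dvdE j : (D %| `|d| * h * j)%N = (q %| j)%N.
  have := dvdz_mul_gcd D (`|d| * h)%N j%:Z D_gt0.
  by rewrite dvdzE abszM /= gcdnC.
(* Take [j = g] in [D_dvdE]: [|d| h g = |d| n] is a multiple of [D]. *)
have q_dvd_g : (q %| g)%N by rewrite -D_dvdE -mulnA -nE dvdn_mull.
have hq_dvd_n : (h * q %| n)%N by rewrite nE dvdn_mul.
have termE (k : nat) : ((n%:Z %| (e * k%:Z)%R)%Z * (D%:Z %| (d * k%:Z)%R)%Z = (h * q %| k)%N)%N.
  rewrite mulnb dvdz_mul_gcd // -/g -/h dvdzE abszM /=.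
  have [/dvdnP[j ->]|ndvd] := boolP (h %| k)%N.
    by rewrite /= [(j * h)%N]mulnC mulnA D_dvdE dvdn_pmul2l.
  by congr (nat_of_bool _); apply/esym/negbTE; apply: contra ndvd; apply: dvdn_trans (dvdn_mulr _ _).
under eq_bigr => k _ do rewrite termE.
rewrite sum_dvdn // [in LHS]nE divnMA mulKn //.
by rewrite -[in LHS](divnK f_dvd) -/q mulnA divnK.
Qed.

(** Here [t] stands for [x_0] and [y] for the remaining coordinates; the offsets [y i 0 - t] stay
    unreduced integers. [F] is arbitrary so that an induction on [m] can absorb a peeled offset into
    it. *)
Definition offset_sum (n : nat) (e t : int) (m : nat) (F : int -> nat) : nat :=
  \sum_(y : 'cV['I_n]_m)
    [forall i, (n%:Z %| (e * ((y i 0)%:Z - t))%R)%Z]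
    * F (\sum_i ((y i 0)%:Z - t))%R.

Lemma forall_ordS (m : nat) (P : pred 'I_m.+1) :
  [forall i, P i] = P ord0 && [forall i : 'I_m, P (lift ord0 i)].
Proof.
apply/forallP/andP => [H|[H0 /forallP H] i]; first by split=> //; apply/forallP.
by case: (unliftP ord0 i) => [j|] ->.
Qed.

Lemma col_mx_ord0 (T : Type) (m : nat) (t : T) (y : 'cV[T]_m) :
  (col_mx (const_mx t : 'cV_1) y : 'cV_m.+1) ord0 0 = t.
Proof. by rewrite mxE; case: splitP => // j; rewrite mxE. Qed.

Lemma col_mx_lift0 (T : Type) (m : nat) (t : T) (y : 'cV[T]_m) (i : 'I_m) :
  (col_mx (const_mx t : 'cV_1) y : 'cV_m.+1) (lift ord0 i) 0 = y i 0.
Proof.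
rewrite mxE; case: splitP => [j /=|k /= [/val_inj ->] //].
by move=> jE; have := ltn_ord j; rewrite -jE.
Qed.

Lemma offset_sum0 (n : nat) (e t : int) (F : int -> nat) :
  offset_sum n e t 0 F = F 0.
Proof.
rewrite /offset_sum (eq_bigr (fun=> F 0)); last first.
  move=> y _; rewrite big_ord0 (_ : [forall i, _] = true) ?mul1n //.
  by apply/forallP => -[].
by rewrite sum_nat_const card_mx mul0n mul1n.
Qed.

Lemma offset_sumS (n : nat) (e t : int) (m : nat) (F : int -> nat) :
  offset_sum n e t m.+1 F =
  (\sum_(k < n) (n%:Z %| (e * (k%:Z - t))%R)%Z
    * offset_sum n e t m (fun s => F (k%:Z - t + s)%R))%N.
Proof.
rewrite /offset_sum sum_cV_recl; apply: eq_bigr => k _.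
rewrite big_distrr /=; apply: eq_bigr => y _.
rewrite forall_ordS big_ord_recl !col_mx_ord0 -mulnb -mulnA.
congr (_ * (nat_of_bool _ * F (_ + _)%R))%N.
  by apply: eq_forallb => i; rewrite col_mx_lift0.
by apply: eq_bigr => i _; rewrite col_mx_lift0.
Qed.

(** By induction, all offsets but the first collapse to a single one. Translating it by the first,
    which is also killed by [e] mod [n], removes the first from the argument of [F]; the first then
    only contributes a factor [gcdn |e| n]. *)
Lemma offset_sumE (n : nat) (e t : int) (m : nat) (F : int -> nat) : (0 < n)%N ->
  (forall z w, (n%:Z %| z - w)%Z -> F z = F w) ->
  offset_sum n e t m.+1 F =
  (gcdn `|e| n ^ m * \sum_(k < n) (n%:Z %| (e * k%:Z)%R)%Z * F k%:Z)%N.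
Proof.
move=> n_gt0; elim: m F => [|m IHm] F perF; rewrite offset_sumS.
  under eq_bigr => k _ do rewrite offset_sum0 addr0.
  rewrite mul1n.
  apply: (sum_residues_shift n (fun z => (n%:Z %| (e * z)%R)%Z * F z)%N (- t)) => //.
  move=> z w zw; rewrite (perF _ _ zw) (dvdz_congr _ _ (e * w)) //.
  by rewrite -mulrBr dvdz_mull.
(* One factor of the power is turned back into a count of offsets [k - t], so that both sides are
   compared term by term in [k]. *)
rewrite expnS -mulnA -{1}(sum_dvdz_mul n e n_gt0).
rewrite -(sum_residues_shift n (fun z => (n%:Z %| (e * z)%R)%Z : nat) (- t)) //; last first.
  by move=> z w zw; rewrite (dvdz_congr _ _ (e * w)) // -mulrBr dvdz_mull.
rewrite big_distrl /=; apply: eq_bigr => k _.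
case: (boolP (n%:Z %| e * (k%:Z - t))%Z) => [ekt|]; last by rewrite !mul0n.
rewrite !mul1n IHm => [|z w zw]; last by apply: perF; rewrite opprD addrACA subrr add0r.
congr (_ * _)%N.
rewrite -[RHS](sum_residues_shift n (fun z => (n%:Z %| (e * z)%R)%Z * F z)%N (k%:Z - t)) //.
  apply: eq_bigr => j _; rewrite [_ - t + _]addrC; congr (nat_of_bool _ * _)%N.
  by apply: dvdz_congr; rewrite -mulrBr opprD addrA subrr sub0r mulrN rpredN.
move=> z w zw; rewrite (perF _ _ zw) (dvdz_congr _ _ (e * w)) //.
by rewrite -mulrBr dvdz_mull.
Qed.

(** [Bmx] is [(c - d) I + d J], with [J] the all-ones matrix. *)
Lemma Bmx_mul_colE (r : nat) (c d : int) (x : 'cV[int]_r) (i : 'I_r) :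
  (Bmx r c d *m x) i 0 = (c - d) * x i 0 + d * \sum_j x j 0.
Proof.
rewrite mxE (bigD1 i) //= [in RHS](bigD1 i) //= mxE eqxx mulrDr addrA -mulrDl subrK.
congr (_ + _); rewrite big_distrr /=; apply: eq_bigr => j ji.
by rewrite mxE eq_sym (negbTE ji).
Qed.

Lemma S_cochar_offset_sum (c d : int) (m n : nat) :
  S_cochar c d m.+1 n =
  (\sum_(k < n) offset_sum n (c - d) k%:Z m
    (fun s => (n%:Z %| ((c + m%:Z * d) * k%:Z + d * s)%R)%Z : nat))%N.
Proof.
rewrite /S_cochar cardsE -sum1_card big_mkcond /= sum_cV_recl.
apply: eq_bigr => k _; apply: eq_bigr => y _.
pose x : 'cV['I_n]_m.+1 := @col_mx _ 1 m 1 (const_mx k) y; rewrite -/x; set s := \sum_i _.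
have sumE : \sum_j lift_residues x j 0 = m.+1%:Z * k%:Z + s.
  rewrite big_ord_recl mxE col_mx_ord0 /s big_split /= sumr_const card_ord.
  under eq_bigr => i _ do rewrite mxE col_mx_lift0.
  rewrite -mulr_natl intS; ring.
rewrite -[LHS]/(nat_of_bool [forall i : 'I_m.+1,
  (((Bmx m.+1 c d *m lift_residues x) i 0)%R == 0 %[mod n%:Z])%Z]).
have entryE i : (((Bmx m.+1 c d *m lift_residues x) i 0)%R == 0 %[mod n%:Z])%Z =
    (n%:Z %| (c - d) * (x i 0%R)%:Z + d * (m.+1%:Z * k%:Z + s))%Z.
  by rewrite Bmx_mul_colE sumE mxE eqz_mod_dvd subr0.
rewrite (eq_forallb entryE) mulnb forall_ordS col_mx_ord0.
have -> : (c - d) * k%:Z + d * (m.+1%:Z * k%:Z + s) = (c + m%:Z * d) * k%:Z + d * s.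
  by rewrite intS; ring.
(* Once row 0 vanishes mod [n], any other row may be replaced by its difference with row 0, which is
   [(c - d) (y i 0 - k)]. *)
rewrite andbC; case: (boolP (n%:Z %| (c + _) * _ + _)%Z) => [n_dvd|]; last by rewrite !andbF.
rewrite !andbT; congr nat_of_bool.
apply: eq_forallb => i; rewrite col_mx_lift0; apply: dvdz_congr.
by rewrite [_ - _](_ : _ = (c + m%:Z * d) * k%:Z + d * s) // intS; ring.
Qed.

Theorem theorem4p7 (r n : nat) (hr : (1 <= r)%N) (hn : (1 <= n)%N) (c d : int) :
  let d1 : int := gcdz (c - d) n%:Z in
  let d2 : int := gcdz (c + (r%:Z - 1) * d) n%:Z in
  (S_cochar c d r n)%:Z = d1 ^+ (r - 1) * gcdz d2 ((d * n%:Z) %/ d1)%Z.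
Proof.
case: r hr => // m _ d1 d2.
have d2E : d2 = gcdz (c + m%:Z * d) n%:Z by rewrite /d2 intS addrAC subrr add0r.
rewrite {}d2E {d2} subn1 /=; set a := c + _; set d2 := gcdz a _.
rewrite S_cochar_offset_sum -/a; case: m @a @d2 => [|m] a d2.
  under eq_bigr => k _ do rewrite offset_sum0.
  rewrite sum_dvdz_affine // mulr0 dvdz0 mul1n expr0 mul1r.
  (* With [n = q d1] and [c - d = p d1], and [a = c] here, [d n / d1 = (a - p d1) q = a q - p n];
     [d2] divides both [a] and [n]. *)
  suff /gcdz_idPl -> : (d2 %| (d * n%:Z) %/ d1)%Z by [].
  have /dvdzP[q nE] : (d1 %| n%:Z)%Z := dvdz_gcdr _ _.
  have /dvdzP[p cdE] : (d1 %| c - d)%Z := dvdz_gcdl _ _.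
  have -> : ((d * n%:Z) %/ d1)%Z = a * q - p * n%:Z.
    have d1_neq0 : d1 != 0 by apply/eqP => d1_0; rewrite d1_0 mulr0 in nE; lia.
    have aE : a = d + p * d1 by rewrite -cdE /a; ring.
    by rewrite aE nE mulrA mulzK //; ring.
  apply: rpredB; [apply: dvdz_mulr (dvdz_gcdl _ _)|apply: dvdz_mull (dvdz_gcdr _ _)].
under eq_bigr => k _.
  rewrite offset_sumE //; last first.
    move=> z w zw; rewrite (dvdz_congr _ _ (a * k%:Z + d * w)) //.
    by rewrite opprD addrACA subrr add0r -mulrBr dvdz_mull.
  over.
(* The order of summation is swapped so that [x_0] is counted for a fixed offset, by
   [sum_dvdz_affine]. *)
rewrite -big_distrr exchange_big /=.
under eq_bigr => k _ do rewrite -big_distrr /= sum_dvdz_affine // mulnA.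
rewrite -big_distrl /= sum_dvdz_pair ?dvdn_gcdr //.
(* [r] is now [m + 2]: the offsets gave [d1 ^ m], and the pair count supplies the missing factor
   [d1]. *)
rewrite mulnA -expnSr PoszM; set g := gcdn _ n.
have -> : (g ^ m.+1)%N%:Z = d1 ^+ m.+1 by rewrite -[LHS]natz natrX natz.
congr (_ * (gcdn _ _)%:Z).
have g_dvd : (g %| n)%N := dvdn_gcdr _ _.
have g_gt0 : (0 < g)%N by rewrite gcdn_gt0 hn orbT.
rewrite -[d1]/(g%:Z) -{2}(divnK g_dvd) PoszM mulrA mulzK ?eqz_nat -?lt0n //.
by rewrite abszM muln_divA.
Qed.
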